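(* Let $n\ge 2$. The number $nr_=(n,1)$ of isomorphism classes of Steiner triple systems on $2^n-1$ points with $2$-rank exactly $2^n-n$ satisfies $$nr_=(n,1)\ge \frac{2^{(2^{n-1}-1)(2^{n-2}-1)/3}}{2^{2^{n-1}-1}\cdot|PGL(n-1,2)|}-1.$$
   Context: The $2$-rank of a Steiner triple system is the rank over $\mathrm{GF}(2)$ of its block-by-point incidence matrix. $PGL(m,2)=GL(m,2)$, of order $\prod_{i=0}^{m-1}(2^m-2^i)$. *)

(* Defs.v *)
From HB Require Import structures.
From mathcomp Require Import all_boot all_order all_algebra all_fingroup.

Set Implicit Arguments.
Unset Strict Implicit.
Unset Printing Implicit Defensive.

Import Order.TTheory GRing.Theory Num.Theory.
Local Open Scope ring_scope.

Definition is_sts (T : finType) (B : {set {set T}}) : bool :=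
  [forall b in B, #|b| == 3%N] &&
  [forall x, forall y, (x != y) ==>
     (#|[set b in B | (x \in b) && (y \in b)]| == 1%N)].

(* The order in which [enum_val] lists the blocks and the points does not
   affect the rank. *)
Definition incidence_mx (T : finType) (B : {set {set T}}) :
    'M['F_2]_(#|B|, #|T|) :=
  \matrix_(i, j) (enum_val j \in (enum_val i : {set T}))%:R.

Definition rank2 (T : finType) (B : {set {set T}}) : nat :=
  \rank (incidence_mx B).

Definition sts_iso (T : finType) (B C : {set {set T}}) : bool :=
  [exists s : {perm T}, [set s @: (b : {set T}) | b in B] == C].

Lemma sts_iso_equiv (T : finType) : equivalence_rel (@sts_iso T).
Proof.
have refl B : @sts_iso T B B.
  apply/existsP; exists 1%g; apply/eqP.
  rewrite -[RHS]imset_id; apply: eq_imset => b.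
  by rewrite -[RHS]imset_id; apply: eq_imset => x; rewrite perm1.
have sym B C : @sts_iso T B C -> sts_iso C B.
  case/existsP=> s /eqP <-; apply/existsP; exists s^-1%g; apply/eqP.
  rewrite -imset_comp -[RHS]imset_id; apply: eq_imset => b /=.
  rewrite -imset_comp -[RHS]imset_id; apply: eq_imset => x /=.
  exact: permK.
have trans B C D : @sts_iso T B C -> sts_iso C D -> sts_iso B D.
  case/existsP=> s /eqP <- /existsP[t /eqP <-].
  apply/existsP; exists (s * t)%g; apply/eqP.
  rewrite -imset_comp; apply: eq_imset => b /=.
  by rewrite -imset_comp; apply: eq_imset => x /=; rewrite permM.
move=> B C D; split=> // BC; apply/idP/idP; last exact: trans.
exact: trans (sym _ _ BC).
Qed.

(* Number of isomorphism classes of Steiner triple systems on v points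
   with 2-rank exactly r. *)
Definition num_sts_rank2 (v r : nat) : nat :=
  #|equivalence_partition (@sts_iso 'I_v)
      [set B : {set {set 'I_v}} | is_sts B && (rank2 B == r)]|.

(* nr_=(n, 1); no truncation occurs in the subtractions since n < 2 ^ n. *)
Definition nr_eq1 (n : nat) : nat := num_sts_rank2 (2 ^ n - 1) (2 ^ n - n).

(* Main.v *)
(* Let V = GF(2)^m with m = n - 1. Take as points the nonzero vectors of
   V x GF(2). For each of the 2^L sets S of lines of V (L the number of lines),
   twisting by S the lines of PG(m, 2) that lie over a line of V gives a Steiner
   triple system. Its null space over GF(2) contains the m-dimensional space of
   linear forms pulled back from V. If it contains anything more, then S is
   determined by a function V \ {0} -> GF(2), so at most 2^(2^m - 1) sets S fail
   to give rank 2^n - n. An isomorphism between two systems of rank 2^n - n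
   preserves their common null space, hence has the form
   (x, i) |-> (x A, i + f x) with A invertible, so that an isomorphism class
   contains at most 2^(2^m - 1) |GL(m, 2)| of these systems. *)

Require Import Defs.
From mathcomp Require Import all_boot all_order all_algebra all_fingroup.

Set Implicit Arguments.
Unset Strict Implicit.
Unset Printing Implicit Defensive.

Import Order.TTheory GRing.Theory Num.Theory.
Local Open Scope ring_scope.

(** * Three-element sets *)

Section Triples.

Variable T : finType.
Implicit Types (A : {set T}) (x y z : T).

Lemma cards3 x y z : x != y -> x != z -> y != z -> #|[set x; y; z]| = 3%N.
Proof.
move=> xy xz yz; rewrite setUC cardsU1 cards2 !inE xy.
by rewrite ![z == _]eq_sym (negPf xz) (negPf yz).
Qed.

Lemma big_set3 (V : nmodType) (F : T -> V) x y z :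
  x != y -> x != z -> y != z ->
  \sum_(a in [set x; y; z]) F a = F x + F y + F z.
Proof.
move=> xy xz yz; rewrite setUC big_setU1 /=; last first.
  by rewrite !inE ![z == _]eq_sym (negPf xz) (negPf yz).
by rewrite big_setU1 /= ?inE // big_set1 addrC.
Qed.

Lemma card3_third A x y : #|A| = 3%N -> x \in A -> y \in A -> x != y ->
  exists z, [/\ x != z, y != z & A = [set x; y; z]].
Proof.
move=> A3 xA yA xy.
have yA' : y \in A :\ x by rewrite !inE eq_sym xy.
move: A3; rewrite (cardsD1 x) xA (cardsD1 y (A :\ x)) yA' => -[].
move/eqP/cards1P=> [z Az]; exists z.
have: z \in A :\ x :\ y by rewrite Az inE.
rewrite !inE => /and3P[zy zx zA].
split; rewrite 1?eq_sym //.
by rewrite -(setD1K xA) -(setD1K yA') Az setUA.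
Qed.

Lemma card3P A : #|A| = 3%N ->
  exists x y z, [/\ x != y, x != z, y != z & A = [set x; y; z]].
Proof.
move=> A3; have /card_gt0P[x xA] : (0 < #|A|)%N by rewrite A3.
have : (0 < #|A :\ x|)%N by move: A3; rewrite (cardsD1 x) xA add1n => -[->].
case/card_gt0P=> y; rewrite !inE eq_sym => /andP[xy yA].
have [z [xz yz ->]] := card3_third A3 xA yA xy.
by exists x, y, z.
Qed.

Lemma card_off_diagonal A :
  #|[set u in setX A A | u.1 != u.2]| = (#|A| * (#|A| - 1))%N.
Proof.
have -> : [set u in setX A A | u.1 != u.2] =
    setX A A :\: [set (x, x) | x in A].
  apply/setP=> -[x y]; rewrite !inE /= andbC.
  case: (boolP ((x \in A) && (y \in A))) => [/andP[xA yA] | _]; last first.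
    by rewrite !andbF.
  rewrite !andbT; congr (~~ _); apply/eqP/imsetP=> [<- | [z _ [-> ->]] //].
  by exists x.
rewrite cardsD (setIidPr _); last first.
  by apply/subsetP=> _ /imsetP[x xA ->]; rewrite inE /= xA.
by rewrite cardsX card_imset ?mulnBr ?muln1 // => x y [].
Qed.

End Triples.

(** * The null space of the incidence matrix *)

Section Rank.

Variable T : finType.
Implicit Type B : {set {set T}}.

Definition is_null B (g : T -> 'F_2) : Prop :=
  forall b, b \in B -> \sum_(a in b) g a = 0.

Lemma is_nullP B (w : 'rV_#|T|) :
  w *m (incidence_mx B)^T = 0 <-> is_null B (fun a => w 0 (enum_rank a)).
Proof.
have E (i : 'I_#|B|) : (w *m (incidence_mx B)^T) 0 i =
    \sum_(a in enum_val i) w 0 (enum_rank a).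
  rewrite !mxE (reindex enum_rank) /=; last exact/onW_bij/enum_rank_bij.
  rewrite [RHS]big_mkcond; apply: eq_bigr => a _; rewrite !mxE enum_rankK.
  by case: (a \in _); rewrite ?mulr1 ?mulr0.
split=> [w0 b bB | nB]; last first.
  by apply/rowP=> i; rewrite E mxE; apply: nB; apply: enum_valP.
by rewrite -(enum_rankK_in bB bB) -E w0 mxE.
Qed.

(* The rank is codim of the null space, so it equals [#|T| - m] exactly when
   the m-dimensional space of the functions [P^T u] is the whole null space. *)
Lemma rank2_coordinates m B (P : T -> 'rV['F_2]_m) :
  (forall x, x != 0 -> exists a, P a = x) ->
  (forall b, b \in B -> \sum_(a in b) P a = 0) ->
  rank2 B = (#|T| - m)%N <->
  (forall g, is_null B g -> exists u : 'cV_m, forall a, g a = (P a *m u) 0 0).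
Proof.
move=> P_surj P_null; set M := (incidence_mx B)^T.
pose U : 'M['F_2]_(m, #|T|) := \matrix_(i, j) P (enum_val j) 0 i.
have uU (u : 'rV_m) a : (u *m U) 0 (enum_rank a) = (P a *m u^T) 0 0.
  rewrite !mxE; apply: eq_bigr => i _; rewrite !mxE enum_rankK.
  exact: mulrC.
have UM (u : 'rV_m) : u *m U *m M = 0.
  apply/is_nullP => b bB; rewrite (eq_bigr _ (fun a _ => uU u a)).
  by rewrite -summxE -mulmx_suml P_null // mul0mx mxE.
have leU : (U <= kermx M)%MS.
  by apply/sub_kermxP/row_matrixP=> i; rewrite row_mul rowE row0; apply: UM.
have rU : \rank U = m.
  apply/eqP; rewrite -[_ == _]/(row_free U) -kermx_eq0; apply/rowV0P => u.
  move/sub_kermxP=> uU0; apply/rowP=> i; rewrite mxE.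
  (* Evaluating [u *m U] at a point over a basis vector reads off one coordinate of [u], so the rows
     of [U] are independent. *)
  have [a Pa] : exists a, P a = delta_mx 0 i.
    apply: P_surj; apply/eqP => /rowP/(_ i); rewrite !mxE !eqxx.
    by move/eqP; rewrite oner_eq0.
  by have := uU u a; rewrite uU0 Pa -rowE !mxE => <-.
have rker : \rank (kermx M) = (#|T| - rank2 B)%N.
  by rewrite mxrank_ker mxrank_tr.
have rB : (rank2 B <= #|T|)%N by apply: rank_leq_col.
have mT : (m <= #|T|)%N by rewrite -rU rank_leq_col.
have rP : rank2 B = (#|T| - m)%N <-> (kermx M <= U)%MS.
  rewrite -(mxrank_leqif_sup leU) rU rker; split=> [-> | /eqP ->].
    by rewrite subKn.
  by rewrite subKn.
apply: (iff_trans rP); split=> [leM g g_null | coord].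
  pose w : 'rV_#|T| := \row_j g (enum_val j).
  have : (w <= U)%MS.
    apply: submx_trans leM; apply/sub_kermxP/is_nullP => b bB.
    rewrite -[RHS](g_null b bB); apply: eq_bigr => a _.
    by rewrite mxE enum_rankK.
  case/submxP=> u wE; exists u^T => a.
  by rewrite -uU -wE mxE enum_rankK.
apply/row_subP=> i; set w := row i _.
have /is_nullP/coord[u wu] : w *m M = 0.
  by apply/sub_kermxP; apply: row_sub.
apply/submxP; exists u^T; apply/rowP=> j.
by rewrite -(enum_valK j) uU wu trmxK.
Qed.

End Rank.

(** * Vectors over GF(2) *)

Lemma F2_cases (a : 'F_2) : a = 0 \/ a = 1.
Proof. by case: a => [[|[|//]] ?]; [left | right]; apply/val_inj. Qed.

Lemma F2_neq (a b : 'F_2) : a != b -> b = 1 + a.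
Proof.
by case: (F2_cases a) => ->; case: (F2_cases b) => -> // _; apply/val_inj.
Qed.

Lemma F2_bool (a : 'F_2) : a = (a == 1)%:R.
Proof. by case: (F2_cases a) => ->. Qed.

Lemma addrr_lmod2 (V : lmodType 'F_2) (x : V) : x + x = 0.
Proof.
rewrite -mulr2n -scaler_nat (_ : 2%:R = 0 :> 'F_2) ?scale0r //.
exact/val_inj.
Qed.

Lemma oppr_lmod2 (V : lmodType 'F_2) (x : V) : - x = x.
Proof. by apply/eqP; rewrite eq_sym -addr_eq0 addrr_lmod2. Qed.

(* Over GF(2) additivity only has to be assumed on distinct nonzero pairs. *)
Lemma F2_additive_coordinates m (f : 'rV['F_2]_m -> 'F_2) : f 0 = 0 ->
  (forall x y, x != 0 -> y != 0 -> x != y -> f (x + y) = f x + f y) ->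
  exists u : 'cV_m, forall x, f x = (x *m u) 0 0.
Proof.
move=> f0 fD'.
have fD x y : f (x + y) = f x + f y.
  have [->|x0] := eqVneq x 0; first by rewrite f0 !add0r.
  have [->|y0] := eqVneq y 0; first by rewrite f0 !addr0.
  have [->|xy] := eqVneq x y; last exact: fD'.
  by rewrite addrr_lmod2 f0 (addrr_lmod2 (f y : ('F_2)^o)).
exists (\col_i f (delta_mx 0 i)) => x.
rewrite [in LHS](row_sum_delta x) (big_morph f fD f0) !mxE.
apply: eq_bigr => i _; rewrite mxE.
by case: (F2_cases (x 0 i)) => ->; rewrite ?scale0r ?scale1r ?mul0r ?mul1r.
Qed.

Lemma neq_addr (V : zmodType) (x y : V) : y != 0 -> x != x + y.
Proof. by move=> y0; rewrite eq_sym -subr_eq0 addrAC subrr add0r. Qed.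

Lemma neq_addl (V : zmodType) (x y : V) : y != 0 -> x != y + x.
Proof. by rewrite addrC; apply: neq_addr. Qed.

(** * Lines over GF(2) *)

Section Lines.

Variable m : nat.
Local Notation V := 'rV['F_2]_m.

(** Over GF(2) a projective line is a plane through the origin minus 0, that is, three distinct
    nonzero vectors of sum 0. *)
Definition lines : {set {set V}} :=
  [set l : {set V} | [&& #|l| == 3%N, 0 \notin l & \sum_(x in l) x == 0]].

Lemma mem_lines (x y : V) : x != 0 -> y != 0 -> x != y ->
  [set x; y; x + y] \in lines.
Proof.
move=> x0 y0 xy.
have xz := neq_addr x y0; have yz := neq_addl y x0.
rewrite inE cards3 // big_set3 // addrr_lmod2 !inE !(eq_sym 0).
by rewrite (negPf x0) (negPf y0) addr_eq0 oppr_lmod2 (negPf xy) !eqxx.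
Qed.

Lemma linesP (l : {set V}) : l \in lines ->
  exists x y, [/\ x != 0, y != 0, x != y & l = [set x; y; x + y]].
Proof.
rewrite inE => /and3P[/eqP/card3P[x [y [z [xy xz yz ->]]]]].
rewrite big_set3 // addr_eq0 oppr_lmod2 !inE !negb_or => /andP[/andP[x0 y0] _].
by move/eqP=> Ez; exists x, y; rewrite Ez !(eq_sym _ 0); split.
Qed.

Lemma lines0 l : l \in lines -> 0 \notin l.
Proof. by rewrite inE => /and3P[]. Qed.

(* Each of the N(N-1) ordered pairs of distinct nonzero vectors lies on a line,
   which contains only 6 such pairs. *)
Lemma card_lines : ((2 ^ m - 1) * (2 ^ m - 2) <= 6 * #|lines|)%N.
Proof.
pose off (A : {set V}) := [set u in setX A A | u.1 != u.2].
pose third_line (u : V * V) : {set V} := [set u.1; u.2; u.1 + u.2].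
have -> : ((2 ^ m - 1) * (2 ^ m - 2))%N = #|off [set~ 0]|.
  by rewrite card_off_diagonal cardsC1 card_mx card_Fp // mul1n -subn1 -subnDA.
rewrite -sum1_card (partition_big third_line (mem lines)) /=; last first.
  case=> x y; rewrite !inE /= => /andP[/andP[x0 y0] xy].
  by have := mem_lines x0 y0 xy; rewrite !inE.
rewrite mulnC -sum_nat_const; apply: leq_sum => l l_line.
rewrite sum1dep_card.
have <- : #|off l| = 6%N.
  by move: l_line; rewrite inE card_off_diagonal => /and3P[/eqP->].
apply/subset_leq_card/subsetP=> u; rewrite inE => /andP[].
rewrite inE => /andP[_ uu] /eqP <-.
by rewrite !inE uu !eqxx ?orbT.
Qed.

End Lines.

(** * Steiner triple systems from twisted lines *)

Section Doubling.

Variables (m : nat) (T : finType).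
Local Notation V := 'rV['F_2]_m.
Variables (p : T -> V * 'F_2) (q : V * 'F_2 -> T).
Hypotheses (p_neq0 : forall a, p a != 0) (pK : cancel p q).
Hypothesis qK : forall w, w != 0 -> p (q w) = w.
Implicit Types (S : {set {set V}}) (a b c : T).

(* [p] codes the points by the nonzero vectors of V x GF(2), [q] decodes. The
   blocks of PG(m, 2) are the triples of sum 0; those lying over a line in [S]
   are twisted to have sum (0, 1). *)
Definition blocks S : {set {set T}} :=
  [set b : {set T} | (#|b| == 3%N) &&
     (\sum_(a in b) p a == (0, ([set (p a).1 | a in b] \in S)%:R))].

Let p_inj : injective p := can_inj pK.

Let qKl (x : V) i : x != 0 -> p (q (x, i)) = (x, i).
Proof. by move=> x0; rewrite qK //; apply: contraNneq x0 => -[->]. Qed.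

Let addww (w : V * 'F_2) : w + w = 0.
Proof.
case: w => x i; congr (_, _); first exact: addrr_lmod2.
exact: (@addrr_lmod2 ('F_2)^o).
Qed.

Let oppw (w : V * 'F_2) : - w = w.
Proof. by apply/eqP; rewrite eq_sym -addr_eq0 addww. Qed.

Lemma mem_blocks3 S a b c : a != b -> a != c -> b != c ->
  ([set a; b; c] \in blocks S) =
  (p c == p a + p b + (0, ([set (p a).1; (p b).1; (p c).1] \in S)%:R)).
Proof.
move=> ab ac bc; rewrite inE cards3 // big_set3 // !imsetU !imset_set1 /=.
by rewrite -subr_eq0 oppw [in RHS]eq_sym -[in RHS]subr_eq0 oppw [in RHS]addrAC.
Qed.

(* The set below can only be a line if [a] and [b] lie over distinct nonzero
   vectors. *)
Definition third S a b : T :=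
  q (p a + p b + (0, ([set (p a).1; (p b).1; (p a).1 + (p b).1] \in S)%:R)).

Section FixedLines.

Variable S : {set {set V}}.
Hypothesis S_lines : S \subset lines m.

Lemma thirdP a b : a != b ->
  [/\ p (third S a b) =
      p a + p b + (0, ([set (p a).1; (p b).1; (p a).1 + (p b).1] \in S)%:R),
      a != third S a b & b != third S a b].
Proof.
move=> ab.
set l := [set (p a).1; (p b).1; (p a).1 + (p b).1].
have pab : p a != p b by rewrite (inj_eq p_inj).
have -> : third S a b = q (p a + p b + (0, (l \in S)%:R)) by [].
set w := p a + p b + (0, (l \in S)%:R).
have [w0 aw bw] : [/\ w != 0, p a != w & p b != w].
  rewrite {}/w; case: (boolP (l \in S)) => [lS | _] /=; last first.
    by rewrite addr0 neq_addr // neq_addl // addr_eq0 oppw.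
  (* A twisted triple is a genuine line, so the V-components alone already separate the three points
     and show [w] nonzero. *)
  have := lines0 (subsetP S_lines _ lS); rewrite !inE !negb_or !(eq_sym 0).
  case/andP=> /andP[a0 b0] ab0.
  split; apply: contraNneq ab0.
  - by move/(congr1 fst)=> /= /eqP; rewrite addr0.
  - move/(congr1 fst)=> /= /eqP; rewrite addr0 => /eqP E.
    by case/negP: (neq_addr (p a).1 b0); apply/eqP.
  - move/(congr1 fst)=> /= /eqP; rewrite addr0 => /eqP E.
    by case/negP: (neq_addl (p b).1 a0); apply/eqP.
rewrite qK //; split=> //.
  by rewrite -(inj_eq p_inj) qK.
by rewrite -(inj_eq p_inj) qK.
Qed.

Lemma third_block a b : a != b -> [set a; b; third S a b] \in blocks S.
Proof.
move=> ab; have [Ep ac bc] := thirdP ab.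
by rewrite mem_blocks3 // {1}Ep Ep /= addr0.
Qed.

(** The twist changes only the GF(2)-component, so the V-component of the third point is the sum of
    the other two. This fixes the underlying line, hence the twist, hence the point. *)
Lemma block_third (B : {set T}) a b : B \in blocks S ->
  a \in B -> b \in B -> a != b -> B = [set a; b; third S a b].
Proof.
move=> BS aB bB ab; have : #|B| = 3%N by move: BS; rewrite inE => /andP[/eqP].
case/(card3_third)/(_ aB bB ab) => c [ac bc EB].
move: BS; rewrite EB mem_blocks3 // => /eqP Ec.
congr (_ :|: [set _]); apply: p_inj; have [-> _ _] := thirdP ab.
by rewrite {1}Ec Ec /= addr0.
Qed.

Lemma sts_blocks : is_sts (blocks S).
Proof.
apply/andP; split.
  by apply/forallP=> b; apply/implyP; rewrite inE => /andP[].
apply/forallP=> a; apply/forallP=> b; apply/implyP=> ab.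
rewrite (_ : [set _ in _ | _] = [set [set a; b; third S a b]]) ?cards1 //.
apply/setP=> B; rewrite [in RHS]inE [in LHS]inE.
apply/idP/eqP=> [/and3P[BS aB bB] | ->]; first exact: block_third.
by rewrite third_block // !inE !eqxx orbT.
Qed.

Lemma blocks_null (b : {set T}) : b \in blocks S -> \sum_(a in b) (p a).1 = 0.
Proof.
rewrite inE => /andP[_ /eqP/(congr1 fst) /= E]; rewrite -[RHS]E.
by rewrite (big_morph fst (id1 := 0) (op1 := +%R)).
Qed.

(** A block over a given line with two points at level 0: the level of the third tells whether the
    line is in [S]. *)
Lemma blocks_mem_line (x y : V) : x != 0 -> y != 0 -> x != y ->
  [set q (x, 0); q (y, 0); q (x + y, ([set x; y; x + y] \in S)%:R)]
    \in blocks S /\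
  [/\ q (x, 0) != q (y, 0),
      q (x, 0) != q (x + y, ([set x; y; x + y] \in S)%:R) &
      q (y, 0) != q (x + y, ([set x; y; x + y] \in S)%:R)].
Proof.
move=> x0 y0 xy; set l := [set x; y; x + y].
have [px py] := (qKl 0 x0, qKl 0 y0).
have qxy : q (x, 0) != q (y, 0).
  by apply: contraNneq xy => /(congr1 p); rewrite px py => -[->].
have <- : third S (q (x, 0)) (q (y, 0)) = q (x + y, (l \in S)%:R).
  by rewrite /third px py /=; congr (q (_, _)); rewrite /= ?addr0 ?add0r.
by have [_ xz yz] := thirdP qxy; split=> //; apply: third_block.
Qed.

(* [g (q (0, 1))] is the value at the point at infinity. *)
Lemma null_blocks g : is_null (blocks S) g ->
  exists f : V -> 'F_2, [/\ f 0 = 0,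
    forall a, g a = f (p a).1 + (p a).2 * g (q (0, 1)) &
    forall x y, x != 0 -> y != 0 -> x != y ->
      f (x + y) = f x + f y + ([set x; y; x + y] \in S)%:R * g (q (0, 1))].
Proof.
move=> g_null; set e := g (q (0, 1)).
have addF (i : 'F_2) : i + i = 0 by exact: (@addrr_lmod2 ('F_2)^o).
have oppF (i : 'F_2) : - i = i by exact: (@oppr_lmod2 ('F_2)^o).
have inf0 : (0, 1) != 0 :> V * 'F_2 by apply/eqP=> -[].
have pinf : p (q (0, 1)) = (0, 1) by rewrite qK.
(* No point is coded by (0, 0); the value 0 there makes the formula for [g] hold at infinity too. *)
pose f x := if x == 0 then 0 else g (q (x, 0)).
have gE a : g a = f (p a).1 + (p a).2 * e.
  have qa : a = q ((p a).1, (p a).2) by rewrite -surjective_pairing pK.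
  rewrite /f; case: (eqVneq (p a).1 0) => a10.
    have a21 : (p a).2 = 1.
      case: (F2_cases (p a).2) => [a20 | //]; have := p_neq0 a.
      by rewrite [p a]surjective_pairing a10 a20 eqxx.
    by rewrite add0r a21 mul1r [in LHS]qa a10 a21.
  case: (F2_cases (p a).2) => a2.
    by rewrite a2 mul0r addr0 [in LHS]qa a2.
  rewrite a2 mul1r.
  have px := qKl 0 a10.
  have ab : q (0, 1) != q ((p a).1, 0).
    by apply: contraNneq a10 => /(congr1 p); rewrite px pinf => -[<-].
  have := g_null _ (third_block ab).
  have [_ ac bc] := thirdP ab; rewrite big_set3 //.
  have -> : third S (q (0, 1)) (q ((p a).1, 0)) = a.
    apply: p_inj; have [-> _ _] := thirdP ab; rewrite px pinf /= add0r.
    (* Blocks through infinity are never twisted: their V-components include 0, which lies on no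
       line. *)
    rewrite (_ : _ \in S = false) ?addr0; last first.
      apply: contraTF (eqxx (0 : V)) => /(subsetP S_lines)/lines0.
      by rewrite !inE eqxx.
    rewrite [p a in RHS]surjective_pairing a2.
    by congr (_, _); rewrite /= ?add0r ?addr0.
  move/eqP; rewrite addrC addr_eq0 oppF => /eqP->.
  by rewrite addrC.
exists f; split=> //; first by rewrite /f eqxx.
move=> x y x0 y0 xy; have [blk [ab ac bc]] := blocks_mem_line x0 y0 xy.
have := g_null _ blk; rewrite big_set3 // => /eqP.
have xy0 : x + y != 0 by rewrite addr_eq0 oppr_lmod2.
rewrite !gE !qKl //= !mul0r !addr0.
rewrite addrA addr_eq0 oppF => /eqP <-.
by rewrite addrA addF add0r.
Qed.

End FixedLines.

Lemma blocks_inj S1 S2 : S1 \subset lines m -> S2 \subset lines m ->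
  blocks S1 = blocks S2 -> S1 = S2.
Proof.
move=> S1l S2l E; apply/setP=> l.
have [ll | ll] := boolP (l \in lines m); last first.
  by rewrite (contraNF (subsetP S1l l) ll) (contraNF (subsetP S2l l) ll).
have [x [y [x0 y0 xy El]]] := linesP ll.
have [blk [ab ac bc]] := blocks_mem_line S1l x0 y0 xy.
have [_ [_ _]] := blocks_mem_line S2l x0 y0 xy.
have xy0 : x + y != 0 by rewrite addr_eq0 oppr_lmod2.
move: blk; rewrite E mem_blocks3 // !qKl //= -El => /eqP[].
by rewrite !add0r; case: (l \in S1); case: (l \in S2).
Qed.

(** * Deficient rank and isomorphisms *)

Lemma full_rankP S : S \subset lines m ->
  rank2 (blocks S) = (#|T| - m)%N <->
  (forall g, is_null (blocks S) g ->
     exists u : 'cV_m, forall a, g a = ((p a).1 *m u) 0 0).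
Proof.
move=> S_lines; apply: rank2_coordinates => [x x0 | b]; last exact: blocks_null.
by exists (q (x, 0)); rewrite qKl.
Qed.

(* The twists for which [blocks] is again a copy of PG(m, 2). *)
Definition coboundary (F : {set V}) : {set {set V}} :=
  [set l in lines m | \sum_(x in l) (x \in F)%:R == 1 :> 'F_2].

(** By contraposition. A null function vanishing at infinity is additive in the V-component, hence a
    pulled-back linear form. One with value 1 at infinity fails to be additive exactly on the lines
    in [S], so [S] is the coboundary of its support at level 0. *)
Lemma deficient_coboundary S : S \subset lines m ->
  rank2 (blocks S) != (#|T| - m)%N ->
  exists2 F : {set V}, F \subset [set~ 0] & S = coboundary F.
Proof.
move=> S_lines rS.
suff /existsP[F /andP[F0 /eqP ->]] :
    [exists F : {set V}, (F \subset [set~ 0]) && (S == coboundary F)].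
  by exists F.
apply: contraNT rS => noF; apply/eqP/(full_rankP S_lines) => g g_null.
have [f [f0 gE fD]] := null_blocks S_lines g_null.
case: (F2_cases (g (q (0, 1)))) => e.
  have [|u uE] := F2_additive_coordinates f0.
    by move=> x y x0 y0 xy; rewrite fD // e mulr0 addr0.
  by exists u => a; rewrite gE e mulr0 addr0.
case/negP: noF; apply/existsP; exists [set x | f x == 1]; apply/andP; split.
  apply/subsetP=> x; rewrite !inE; apply: contraTneq => ->.
  by rewrite f0 eq_sym oner_eq0.
apply/eqP/setP=> l; rewrite [in RHS]inE.
have [ll | ll] := boolP (l \in lines m); last first.
  by apply: contraNF ll; apply: subsetP.
have [x [y [x0 y0 xy El]]] := linesP ll.
rewrite {2}El big_set3 //; last 2 first.
- exact: neq_addr.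
- exact: neq_addl.
rewrite !inE -!F2_bool fD // e mulr1 -El addrA.
rewrite (@addrr_lmod2 ('F_2)^o) add0r.
by case: (l \in S).
Qed.

(** Each V-coordinate composed with [s] is null for [blocks S1], hence linear by the rank
    hypothesis; these forms are the columns of [A]. *)
Lemma iso_affine S1 S2 (s : {perm T}) :
  S1 \subset lines m -> S2 \subset lines m ->
  rank2 (blocks S1) = (#|T| - m)%N ->
  [set s @: (b : {set T}) | b in blocks S1] = blocks S2 ->
  exists A : 'M['F_2]_m, exists F : {set V},
    [/\ A \in unitmx, F \subset [set~ 0] &
     forall a, p (s a) = ((p a).1 *m A, (p a).2 + ((p a).1 \in F)%:R)].
Proof.
move=> S1l S2l r1 sB.
have s_null j : is_null (blocks S1) (fun a => (p (s a)).1 0 j).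
  move=> b bB.
  have sb : s @: b \in blocks S2 by rewrite -sB imset_f.
  have := blocks_null sb; rewrite big_imset => [|? ? _ _ /perm_inj //].
  by move/rowP/(_ j); rewrite summxE mxE.
have /fin_all_exists[u uE] := fun j => (full_rankP S1l).1 r1 _ (s_null j).
pose A : 'M['F_2]_m := \matrix_(i, j) u j i 0.
have sA a : (p (s a)).1 = (p a).1 *m A.
  apply/rowP=> j; rewrite uE !mxE; apply: eq_bigr => i _.
  by rewrite mxE.
have over_neq a b : a != b -> (p (s a)).1 = (p (s b)).1 ->
    (p (s a)).2 != (p (s b)).2.
  move=> ab E1; apply: contraNneq ab => E2.
  apply/eqP; apply: (@perm_inj _ s); apply: p_inj.
  by rewrite [LHS]surjective_pairing E1 E2 -surjective_pairing.
have q_neq (x : V) : x != 0 -> q (x, 0) != q (x, 1).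
  by move=> x0; apply/eqP=> /(congr1 p); rewrite !qKl // => -[].
have q_over (x : V) : x != 0 ->
    (p (s (q (x, 1)))).2 = 1 + (p (s (q (x, 0)))).2.
  move=> x0; have := over_neq _ _ (q_neq x x0).
  by rewrite !sA !qKl // => /(_ erefl)/F2_neq.
have Au : A \in unitmx.
  (* A nonzero [x] in the kernel would send both points over [x] to infinity, the only point over
     0. *)
  rewrite -row_free_unit -kermx_eq0; apply/rowV0P => x /sub_kermxP xA.
  apply/eqP; apply: contraT => x0; have := q_over x x0.
  have p1 i : (p (s (q (x, i)))).2 = 1.
    case: (F2_cases (p (s (q (x, i)))).2) => // p0.
    have := p_neq0 (s (q (x, i))).
    by rewrite [p _]surjective_pairing p0 sA qKl //= xA eqxx.
  by rewrite !p1 => /eqP.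
(* [F] marks the fibres whose two levels are swapped; 0 is left out because infinity is fixed. *)
pose F := [set x in [set~ 0] | (p (s (q (x, 0)))).2 == 1].
exists A, F; split=> // [|a].
  by apply/subsetP=> x; rewrite inE => /andP[].
rewrite [LHS]surjective_pairing sA; congr (_, _).
have qa : a = q ((p a).1, (p a).2) by rewrite -surjective_pairing pK.
rewrite !inE; have [a0 | a0] /= := eqVneq (p a).1 0.
  have p2 b : (p b).1 = 0 -> (p b).2 = 1.
    move=> b1; case: (F2_cases (p b).2) => [b2 | //]; have := p_neq0 b.
    by rewrite [p b]surjective_pairing b1 b2 eqxx.
  by rewrite addr0 !p2 // sA a0 mul0mx.
rewrite -F2_bool {1}qa; case: (F2_cases (p a).2) => ->; first by rewrite add0r.
exact: q_over.
Qed.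

(** * Counting isomorphism classes *)

Let units := [set A : 'M['F_2]_m | A \in unitmx].

Lemma card_nonzero_vectors : #|[set~ (0 : V)]| = (2 ^ m - 1)%N.
Proof. by rewrite cardsC1 card_mx card_Fp // mul1n subn1. Qed.

Lemma card_iso_blocks S1 : S1 \subset lines m ->
  rank2 (blocks S1) = (#|T| - m)%N ->
  (#|[set B in blocks @: powerset (lines m) | sts_iso (blocks S1) B]|
     <= #|units| * 2 ^ (2 ^ m - 1))%N.
Proof.
move=> S1l r1.
(* A plain function suffices: the images only have to cover all isomorphic systems. *)
pose affine (u : 'M['F_2]_m * {set V}) a :=
  q ((p a).1 *m u.1, (p a).2 + ((p a).1 \in u.2)%:R).
pose image_of u := [set affine u @: (b : {set T}) | b in blocks S1].
rewrite -card_nonzero_vectors -card_powerset -cardsX.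
apply: leq_trans (leq_imset_card image_of _).
apply/subset_leq_card/subsetP=> B; rewrite inE => /andP[/imsetP[S2]].
rewrite powersetE => S2l -> /existsP[s /eqP sB].
have [A [F [Au F0 pE]]] := iso_affine S1l S2l r1 sB.
apply/imsetP; exists (A, F); first by rewrite !inE Au.
rewrite -sB; apply: eq_imset => b; apply: eq_imset => a.
by rewrite /affine -pE pK.
Qed.

(** The summand 1 accounts for the systems of deficient rank, at most one per [F]; the others are
    counted class by class. *)
Lemma card_sts_classes :
  (2 ^ #|lines m| <=
     (#|equivalence_partition (@sts_iso T)
         [set B | is_sts B && (rank2 B == #|T| - m)%N]| * #|units| + 1)
       * 2 ^ (2 ^ m - 1))%N.
Proof.
set G := [set B | _]; set P := equivalence_partition _ G.
pose X := blocks @: powerset (lines m).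
have equivG : {in G & &, equivalence_rel (@sts_iso T)}.
  by move=> B C D _ _ _; apply: sts_iso_equiv.
have partP : partition P G := equivalence_partitionP equivG.
have <- : #|X| = (2 ^ #|lines m|)%N.
  rewrite card_in_imset ?card_powerset // => S1 S2.
  by rewrite !powersetE; apply: blocks_inj.
rewrite -(cardsID G X) mulnDl mul1n leq_add //; last first.
  rewrite -card_nonzero_vectors -card_powerset.
  apply: leq_trans (leq_imset_card (blocks \o coboundary) _).
  apply/subset_leq_card/subsetP=> B /setDP[/imsetP[S]].
  rewrite powersetE => Sl -> ; rewrite inE sts_blocks //=.
  case/(deficient_coboundary Sl)=> F F0 ->.
  by apply/imsetP; exists F; rewrite ?powersetE.
rewrite -sum1_card (partition_big (pblock P) (mem P)) /=; last first.
  by move=> B /setIP[_ BG]; rewrite pblock_mem // (cover_partition partP).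
rewrite -mulnA -sum_nat_const; apply: leq_sum => K KP; rewrite sum1dep_card.
(* A class may contain no twisted system; otherwise any one in it serves as the base point for
   [card_iso_blocks]. *)
have [-> | [B]] := set_0Vmem [set B | (B \in X :&: G) && (pblock P B == K)].
  by rewrite cards0.
rewrite inE => /andP[/setIP[/imsetP[S]]]; rewrite powersetE => Sl -> SG /eqP SK.
have rS : rank2 (blocks S) = (#|T| - m)%N.
  by move: SG; rewrite inE => /andP[_ /eqP].
apply: leq_trans (card_iso_blocks Sl rS).
apply/subset_leq_card/subsetP=> C; rewrite inE => /andP[/setIP[CX CG] /eqP CK].
rewrite inE CX -(pblock_equivalence_partition equivG) // -/P SK -CK.
by rewrite mem_pblock (cover_partition partP).
Qed.

End Doubling.

(** * The bound on 2^n - 1 points *)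

Lemma card_GL_unitmx k :
  #|[set A : 'M['F_2]_k.+1 | A \in unitmx]| = #|'GL_k.+1(2)%g|.
Proof.
rewrite -(card_imset _ (val_inj : injective (@GLval k.+1 'F_2))).
apply: eq_card => A; rewrite inE.
apply/idP/imsetP=> [Au | [u _ ->]]; last exact: (valP u).
by exists (Sub A Au); rewrite ?inE.
Qed.

Lemma nonzero_coding m v : v = (2 ^ m.+1 - 1)%N ->
  exists p : 'I_v -> 'rV['F_2]_m * 'F_2, exists q,
    [/\ forall a, p a != 0, cancel p q & forall w, w != 0 -> p (q w) = w].
Proof.
move=> vE; pose W := ('rV['F_2]_m * 'F_2)%type; pose A := [set~ (0 : W)].
have cA : #|A| = v.
  by rewrite cardsC1 card_prod card_mx !card_Fp // mul1n vE subn1 -expnSr.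
have inf : ((0, 1) : W) \in A by rewrite !inE; apply/eqP=> -[].
exists (fun i => enum_val (cast_ord (esym cA) i)).
(* [inf] only shows that [A] is nonempty; the value of [q] at 0 is irrelevant. *)
exists (fun w => cast_ord cA (enum_rank_in inf w)); split.
- by move=> a; have := enum_valP (cast_ord (esym cA) a); rewrite !inE.
- by move=> a; rewrite enum_valK_in cast_ordKV.
- by move=> w w0; rewrite cast_ordK enum_rankK_in // !inE.
Qed.

(* The division by 3 in the exponent is exact: 3 divides 2 ^ k - 1 for k even.
   Over GF(2), PGL(m, 2) = GL(m, 2). *)
Theorem theorem4p13 (n : nat) (hn : (2 <= n)%N) :
  2 ^+ ((2 ^ (n - 1) - 1) * (2 ^ (n - 2) - 1) %/ 3)%N
    / (2 ^+ (2 ^ (n - 1) - 1)%N * #|'GL_(n - 1)(2)%g|%:R) - 1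
  <= (nr_eq1 n)%:R :> rat.
Proof.
case: n hn => [|[|k]] // _; rewrite /nr_eq1 /num_sts_rank2 !subSS !subn0.
set L := (_ %/ 3)%N; set N := (2 ^ k.+1 - 1)%N; set u := #|_|.
have [p [q [p_neq0 pK qK]]] := nonzero_coding (erefl (2 ^ k.+2 - 1)%N).
have := card_sts_classes p_neq0 pK qK.
rewrite card_ord -subnDA add1n card_GL_unitmx -/u -/N.
set nr := #|equivalence_partition _ _| => le_lines.
have L_le : (L <= #|lines k.+1|)%N.
  rewrite -(mulKn #|lines k.+1| (isT : 0 < 3)%N) leq_div2r //.
  (* Doubling turns 2^k - 1 into 2^(k+1) - 2, the factor in [card_lines]. *)
  rewrite -(leq_pmul2l (isT : 0 < 2)%N) [leqRHS]mulnA.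
  apply: leq_trans (card_lines k.+1).
  by rewrite mulnCA leq_mul2l mulnBr muln1 -expnS leqnn orbT.
have u_gt0 : (0 < u)%N by apply: cardG_gt0.
have le_nat : (2 ^ L <= nr.+1 * (2 ^ N * u))%N.
  apply: leq_trans (leq_pexp2l _ L_le) (leq_trans le_lines _) => //.
  rewrite [(2 ^ N * u)%N]mulnC mulnA leq_mul2r; apply/orP; right.
  (* As [u] is at least 1, the deficient systems cost at most one extra class: this is the final
     -1. *)
  by rewrite mulSn addnC leq_add2r.
rewrite lerBlDr ler_pdivrMr ?mulr_gt0 ?exprn_gt0 ?ltr0n //.
by rewrite natr1 -!natrX -!natrM ler_nat.
Qed.
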